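(* Let $D\subset\mathbb{R}^3$ be a bounded domain, let $u\in C^3(D)$ be a real-valued function, and let $S\subset D$ be a connected closed $C^3$-smooth surface which is the set of zeros of $u$ in $D$, i.e. $S=\{x\in D: u(x)=0\}$. Assume that there is a constant $c_1>0$ such that $$\inf_{s\in S}|\nabla u(s)|\ge 2c_1>0.$$ Let $v\in C^3(D)$ be a real-valued function, and for $\epsilon>0$ set $u_\epsilon:=u+\epsilon v$ on $D$. Then for all sufficiently small $\epsilon>0$ (that is, there exists $\epsilon_0>0$ such that for every $\epsilon\in(0,\epsilon_0)$) there exists a closed $C^3$-smooth surface $S_\epsilon\subset D$ such that $u_\epsilon(x)=0$ for all $x\in S_\epsilon$.
   Context: A closed surface means a nonempty compact two-dimensional embedded submanifold of $\mathbb{R}^3$ without boundary; it is $C^3$-smooth if it is a submanifold of class $C^3$. A domain is a nonempty connected open set. The threshold $\epsilon_0$ may depend on $D$, $u$, $v$ and $S$. *)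

(* Defs.v *)
From HB Require Import structures.
From mathcomp Require Import all_boot all_order all_algebra.
From mathcomp Require Import all_classical all_reals all_analysis.
Import Order.TTheory GRing.Theory Num.Theory.
Import numFieldNormedType.Exports.

Set Implicit Arguments.
Unset Strict Implicit.
Unset Printing Implicit Defensive.

Local Open Scope classical_set_scope.
Local Open Scope ring_scope.

(* The library norm on 'rV[R]_n is the max norm.  It induces the usual topology
   and bounded sets; the length of a gradient is measured with [enorm]. *)
Definition enorm (R : realType) (n : nat) (x : 'rV[R]_n) : R :=
  Num.sqrt (\sum_(i < n) x ord0 i ^+ 2).

Definition partial (R : realType) (n : nat) (i : 'I_n) (f : 'rV[R]_n -> R) :
  'rV[R]_n -> R := 'D_(delta_mx ord0 i) f.

Definition grad (R : realType) (n : nat) (f : 'rV[R]_n -> R) (x : 'rV[R]_n) :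
  'rV[R]_n := \row_i partial i f x.

(* Class C^k on D: every partial derivative of order at most k exists and is
   continuous at each point of D.  This is meant for open D; it then depends
   only on the restriction of f to D, so the values of the total function f
   outside D are irrelevant. *)
Fixpoint Ck (R : realType) (n k : nat) (D : set 'rV[R]_n) (f : 'rV[R]_n -> R)
    {struct k} : Prop :=
  (forall x, D x -> {for x, continuous f}) /\
  match k with
  | 0 => True
  | k'.+1 => forall i : 'I_n,
      (forall x, D x -> derivable f x (delta_mx ord0 i)) /\
      Ck k' D (partial i f)
  end.

Definition Ck_map (R : realType) (n m k : nat) (D : set 'rV[R]_n)
    (f : 'rV[R]_n -> 'rV[R]_m) : Prop :=
  forall j : 'I_m, Ck k D (fun x => f x ord0 j).

Definition Ck_diffeo (R : realType) (n k : nat) (U V : set 'rV[R]_n)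
    (phi : 'rV[R]_n -> 'rV[R]_n) : Prop :=
  exists psi : 'rV[R]_n -> 'rV[R]_n,
    [/\ Ck_map k U phi, Ck_map k V psi,
        forall x, U x -> V (phi x) /\ psi (phi x) = x &
        forall y, V y -> U (psi y) /\ phi (psi y) = y].

(* R^m x {0} inside R^n *)
Definition coord_subspace (R : realType) (n m : nat) : set 'rV[R]_n :=
  [set y | forall j : 'I_n, (m <= j)%N -> y ord0 j = 0].
Arguments coord_subspace : clear implicits.

(* m-dimensional embedded submanifold of R^n of class C^k, without boundary:
   around each of its points there is a C^k slice chart of R^n. *)
Definition embedded_submanifold (R : realType) (n m k : nat)
    (S : set 'rV[R]_n) : Prop :=
  forall p, S p ->
    exists (U V : set 'rV[R]_n) (phi : 'rV[R]_n -> 'rV[R]_n),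
      [/\ open U, U p, open V, Ck_diffeo k U V phi &
          phi @` (U `&` S) = V `&` coord_subspace R n m].

Definition closed_surface (R : realType) (k : nat) (S : set 'rV[R]_3) : Prop :=
  [/\ S !=set0, compact S & embedded_submanifold 2 k S].

Definition domain (R : realType) (n : nat) (D : set 'rV[R]_n) : Prop :=
  [/\ D !=set0, open D & connected D].

(* Main.v *)
Require Import Defs.
From HB Require Import structures.
From mathcomp Require Import all_boot all_order all_algebra.
From mathcomp Require Import all_classical all_reals all_analysis.
From mathcomp Require Import perm lra.
Import Order.TTheory GRing.Theory Num.Theory.
Import numFieldNormedType.Exports.
Local Open Scope classical_set_scope.
Local Open Scope ring_scope.

Set Implicit Arguments.
Unset Strict Implicit.
Unset Printing Implicit Defensive.

(** Away from its critical points, the zero set of a C^3 function is a surface,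
    and near a compact regular zero set the lack of critical points and the
    confinement of the zeros both survive a small perturbation.

    Confinement.  The gradient of u does not vanish on the compact set S, hence
    not on the closure N of a small neighbourhood W of S, and N is compact since
    D is bounded.  For small eps the gradient of u + eps v does not vanish on N
    either.  Since u vanishes only on S, it has no zero on the compact set
    N \ W, and for small eps neither has u + eps v.  So the set S_eps of zeros
    of u + eps v in N is compact and lies in the open set W, where it is the
    zero set of a function without critical points.  It is not empty: on a
    short segment crossing S transversally u changes sign, and so does
    u + eps v for small eps.  These stability claims come from
    [compact_near_perturbation_neq0] and [near_zero_of_perturbation], and are
    put together in [regular_zero_set_persists].

    Smoothness.  Around a zero p of w with partial_i w p <> 0, the map that
    replaces the coordinate x_i by w(x), and swaps it with the last one, sends
    the zero set of w to the hyperplane of the first coordinates.  Its inverse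
    only requires solving one scalar equation that is strictly monotone in x_i,
    so the intermediate value theorem gives existence and continuity of the
    solution.  The first order expansion of [caratheodory_C1] then gives the
    partial derivatives of the inverse as rational expressions in those of w at
    the solution.  For w of class C^k and m < k these expressions show that the
    inverse is of class C^(m+1) if it is of class C^m.  Hence it is as smooth as
    w ([regular_zero_set_submanifold]). *)

Local Notation unit_vec i := (delta_mx ord0 i).

(** * First order expansions and the chain rule *)

Lemma rV_ballP (R : realType) n (x y : 'rV[R]_n) (e : R) : 0 < e ->
  ball x e y <-> forall j, `|x ord0 j - y ord0 j| < e.
Proof.
move=> e0; split=> [[_ xy] j|xy]; first exact: xy.
by split=> // i j; rewrite ord1; exact: xy.
Qed.

Lemma cvg_rV (R : realType) n (T : Type) (F : set_system T) (f : T -> 'rV[R]_n)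
    (l : 'rV[R]_n) : Filter F ->
  (forall j, f t ord0 j @[t --> F] --> l ord0 j) -> f @ F --> l.
Proof.
move=> FF fl; apply/cvg_ballP => e e0.
have : \forall t \near F, forall j, `|l ord0 j - f t ord0 j| < e.
  by apply: filter_forall => j; move/cvgrPdist_lt : (fl j); exact.
by apply: filterS => t ht; apply/rV_ballP.
Qed.

Lemma is_derive_cvg (R : realType) (V : normedModType R) (f : V -> R) x v l :
  h^-1 * (f (h *: v + x) - f x) @[h --> 0^'] --> l -> is_derive x v f l.
Proof.
move=> fl; apply: DeriveDef; first by apply/cvg_ex; exists l.
exact/cvg_lim.
Qed.

Lemma is_derive_line (R : realType) (V : normedModType R) (f : V -> R) x v t :
  derivable f (x + t *: v) v ->
  is_derive t 1 (fun s => f (x + s *: v)) ('D_v f (x + t *: v)).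
Proof.
move=> df; apply: is_derive_cvg.
rewrite (_ : (fun h => _) = (fun h => h^-1 *:
    (f (h *: v + (x + t *: v)) - f (x + t *: v)))); last first.
  apply/funext => h; congr (_ * (f _ - _)).
  by rewrite [h *: 1]mulr1 scalerDl addrCA.
exact: df.
Qed.

Lemma partial_MVT (R : realType) n (f : 'rV[R]_n -> R) (x : 'rV[R]_n)
    (i : 'I_n) (h : R) :
  (forall t : R, Num.min 0 h <= t <= Num.max 0 h ->
     derivable f (x + t *: unit_vec i) (unit_vec i)) ->
  exists2 t : R, Num.min 0 h <= t <= Num.max 0 h &
    f (x + h *: unit_vec i) - f x = partial i f (x + t *: unit_vec i) * h.
Proof.
move=> df; pose g (t : R) := f (x + t *: unit_vec i).
have dg (t : R) : Num.min 0 h <= t <= Num.max 0 h ->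
    is_derive t 1 g (partial i f (x + t *: unit_vec i)).
  by move=> th; exact/is_derive_line/df.
have cg (t : R) : Num.min 0 h <= t <= Num.max 0 h -> {for t, continuous g}.
  move=> th; apply/differentiable_continuous/derivable1_diffP.
  by case: (dg t th).
have [h0|h0] := leP 0 h.
  have [||t] := @MVT_segment R g (fun t => partial i f (x + t *: unit_vec i)) _ _ h0.
  - move=> t; rewrite in_itv/= => /andP[t0 th]; apply: dg.
    by rewrite min_l ?max_r// !ltW.
  - apply: continuous_subspace_itv => t; rewrite in_itv/= => t0h; apply: cg.
    by rewrite min_l ?max_r.
  - rewrite in_itv/= => t0h; rewrite /g scale0r addr0 subr0 => ->.
    by exists t.
have h0' := ltW h0.
have [||t] := @MVT_segment R g (fun t => partial i f (x + t *: unit_vec i)) _ _ h0'.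
- move=> t; rewrite in_itv/= => /andP[t0 th]; apply: dg.
  by rewrite min_r ?max_l// !ltW.
- apply: continuous_subspace_itv => t; rewrite in_itv/= => t0h; apply: cg.
  by rewrite min_r ?max_l.
- rewrite in_itv/= => t0h; rewrite /g scale0r addr0 sub0r mulrN => gh.
  exists t; first exact: t0h.
  by rewrite -[RHS]opprK -gh opprB.
Qed.

(** Carathéodory's form of differentiability: continuous partial derivatives
    give a first order expansion whose coefficients tend to those derivatives.
    Being an exact identity, it passes to quotients and compositions with no
    remainder term.  One moves from x to y by changing one coordinate at a
    time and applies the mean value theorem at each move. *)
Lemma caratheodory_C1 (R : realType) n (D : set 'rV[R]_n) (f : 'rV[R]_n -> R)
    (x : 'rV[R]_n) : open D -> D x -> Ck 1 D f ->
  exists a : 'I_n -> 'rV[R]_n -> R,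
    (forall i, a i @ x --> partial i f x) /\
    (forall y, f y - f x = \sum_i a i y * (y ord0 i - x ord0 i)).
Proof.
move=> oD Dx [_ f1].
(* the m first coordinates are already those of y *)
pose z (y : 'rV[R]_n) (m : nat) : 'rV[R]_n :=
  \row_j (if (j < m)%N then y ord0 j else x ord0 j).
have zS y (i : 'I_n) :
    z y i.+1 = z y i + (y ord0 i - x ord0 i) *: unit_vec i.
  apply/rowP => j; rewrite !mxE ltnS eqxx/=.
  have [->|ji] := eqVneq j i; first by rewrite leqnn ltnn mulr1 addrC subrK.
  by rewrite mulr0 addr0 leq_eqVlt (negbTE (_ : j != i :> nat)).
pose a i (y : 'rV[R]_n) := if y ord0 i == x ord0 i then partial i f x
  else (f (z y i.+1) - f (z y i)) / (y ord0 i - x ord0 i).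
exists a; split=> [i|y].
  have [df [pc _]] := f1 i.
  apply/(@cvgrPdist_lt _ _ _ _ (nbhs_filter x)) => e e0.
  have xD : nbhs x D by exact: open_nbhs_nbhs.
  have xe : nbhs x [set w | `|partial i f x - partial i f w| < e].
    by move/cvgrPdist_lt : (pc _ Dx); exact.
  have [d /= d0 xd] := (nbhs_ballP _ _).1 (filterI xD xe).
  near=> y.
  have xy : ball x d y by near: y; exact: nbhsx_ballx.
  rewrite /a; case: eqP => [_|/eqP yx]; first by rewrite subrr normr0.
  have yx0 : y ord0 i - x ord0 i != 0 by rewrite subr_eq0.
  have zd (t : R) :
      Num.min 0 (y ord0 i - x ord0 i) <= t <= Num.max 0 (y ord0 i - x ord0 i) ->
      ball x d (z y i + t *: unit_vec i).
    move=> ht0; have ht : `|t| <= `|y ord0 i - x ord0 i|.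
      move: ht0; have [h0|h0] := leP 0 (y ord0 i - x ord0 i) => /andP[t1 t2].
        by rewrite !ger0_norm.
      by rewrite !ler0_norm ?lerN2// ltW.
    apply/rV_ballP => // j.
    have xyj : `|x ord0 j - y ord0 j| < d by move: j; apply/rV_ballP.
    rewrite !mxE eqxx/=.
    have [ji|ji] := eqVneq j i.
      subst j; rewrite ltnn mulr1 opprD addrA subrr sub0r normrN.
      by rewrite (le_lt_trans ht)// distrC.
    rewrite mulr0 addr0; case: ifP => // _.
    by rewrite subrr normr0.
  have [t ht] := @partial_MVT R n f (z y i) i (y ord0 i - x ord0 i)
    (fun t ht => df _ (xd _ (zd t ht)).1).
  rewrite -zS => ->; rewrite mulfK//.
  exact: (xd _ (zd t ht)).2.
transitivity (\sum_(i < n) (f (z y i.+1) - f (z y i))).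
  rewrite -(big_mkord xpredT (fun i => f (z y i.+1) - f (z y i))).
  rewrite telescope_sumr//; congr (f _ - f _); apply/rowP => j; rewrite mxE//.
  by rewrite ltn_ord.
apply: eq_bigr => i _; rewrite /a; case: eqP => [yx|/eqP yx].
  by rewrite zS yx subrr scale0r addr0 subrr mulr0.
by rewrite divfK// subr_eq0.
Unshelve. all: by end_near. Qed.

Lemma cvg_along (R : realType) (V : normedModType R) (T : topologicalType)
    (f : V -> T) x v :
  {for x, continuous f} -> f (h *: v + x) @[h --> (0:R)^'] --> f x.
Proof.
move=> fc.
have hx : h *: v + x @[h --> (0:R)^'] --> x.
  apply: cvg_within_filter.
  have : h *: v + x @[h --> (0:R)] --> 0 *: v + x.
    by apply: cvgD; [apply: cvgZr_tmp; exact: cvg_id | exact: cvg_cst].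
  by rewrite scale0r add0r.
exact: (@cvg_comp _ _ _ (fun h : R => h *: v + x) f _ (nbhs x) _ hx fc).
Qed.

Lemma is_derive_comp_C1 (R : realType) (V : normedModType R) n
    (D : set 'rV[R]_n) (f : 'rV[R]_n -> R) (g : V -> 'rV[R]_n) y v :
  open D -> Ck 1 D f -> D (g y) -> {for y, continuous g} ->
  (forall i, derivable (fun y => g y ord0 i) y v) ->
  is_derive y v (f \o g)
    (\sum_i partial i f (g y) * 'D_v (fun y => g y ord0 i) y).
Proof.
move=> oD f1 Dy gc dg; apply: is_derive_cvg => /=.
have [a [ac af]] := caratheodory_C1 oD Dy f1.
rewrite (_ : (fun h => _) = (fun h => \sum_i a i (g (h *: v + y)) *
   (h^-1 * (g (h *: v + y) ord0 i - g y ord0 i)))); last first.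
  apply/funext => h; rewrite af mulr_sumr; apply: eq_bigr => i _.
  by rewrite mulrCA.
apply: cvg_big => [|i _]; first exact: add_continuous.
apply: cvgM; last exact: dg.
exact: (@cvg_comp _ _ _ (fun h : R => g (h *: v + y)) (a i) _ (nbhs (g y)) _
  (cvg_along v gc) (ac i)).
Qed.

(** * Calculus of functions of class C^k *)

Lemma Ck_continuous (R : realType) n k (D : set 'rV[R]_n) f x :
  Ck k D f -> D x -> {for x, continuous f}.
Proof. by case: k => [|k] [fc _]; exact: fc. Qed.

Lemma Ck_map_continuous (R : realType) n m k (D : set 'rV[R]_n)
    (f : 'rV[R]_n -> 'rV[R]_m) x :
  Ck_map k D f -> D x -> {for x, continuous f}.
Proof.
move=> fk Dx; apply: (@cvg_rV _ _ _ _ _ _ (nbhs_filter x)) => j.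
exact: (Ck_continuous (fk j) Dx).
Qed.

Lemma CkW (R : realType) n k (D : set 'rV[R]_n) f : Ck k.+1 D f -> Ck k D f.
Proof.
elim: k f => [|k IH] f [fc df]; split=> // i.
by have [dfi /IH] := df i.
Qed.

Lemma Ck_C1 (R : realType) n k (D : set 'rV[R]_n) f : Ck k.+1 D f -> Ck 1 D f.
Proof. by elim: k f => // k IH f /CkW/IH. Qed.

Lemma Ck_subset (R : realType) n k (D E : set 'rV[R]_n) f :
  E `<=` D -> Ck k D f -> Ck k E f.
Proof.
move=> ED; elim: k f => [|k IH] f [fc df].
all: split=> //; try by move=> x /ED; exact: fc.
move=> i; have [dfi /IH ?] := df i; split=> // x /ED; exact: dfi.
Qed.

(** The values outside the open set D do not matter, so the usual formulas for
    partial derivatives, valid on D only, can be rewritten under [Ck]. *)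
Lemma eq_Ck (R : realType) n k (D : set 'rV[R]_n) f g : open D ->
  (forall x, D x -> f x = g x) -> Ck k D f -> Ck k D g.
Proof.
move=> oD.
have nfg (f' g' : 'rV[R]_n -> R) x : (forall x, D x -> f' x = g' x) -> D x ->
    \forall y \near x, f' y = g' y.
  by move=> fg Dx; apply: filterS (open_nbhs_nbhs (conj oD Dx)) => y /fg.
have cfg (f' g' : 'rV[R]_n -> R) x : (forall x, D x -> f' x = g' x) -> D x ->
    {for x, continuous f'} -> {for x, continuous g'}.
  move=> fg Dx; rewrite /prop_for /continuous_at -fg//; apply: cvg_trans.
  by apply: (@near_eq_cvg _ _ _ (nbhs_filter x)); move: (nfg _ _ _ fg Dx).
elim: k f g => [|k IH] f g fg [fc df].
all: split=> //; try by move=> x Dx; exact: cfg fg Dx (fc _ Dx).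
move=> i; have [dfi ci] := df i; split=> [x Dx|].
  exact: near_eq_derivable (nfg _ _ _ fg Dx) (dfi _ Dx).
by apply: IH ci => x Dx; exact/near_eq_derive/nfg.
Qed.

Lemma grad_neq0P (R : realType) n (f : 'rV[R]_n -> R) x :
  grad f x != 0 <-> exists i, partial i f x != 0.
Proof.
split=> [|[i]]; last by apply: contra_neq => /rowP/(_ i); rewrite !mxE.
apply: contra_neqP => /forallNP di.
by apply/rowP => i; rewrite !mxE; apply/eqP; move: (di i); case: eqP.
Qed.

Lemma Ck_cst (R : realType) n k (D : set 'rV[R]_n) (c : R) : Ck k D (cst c).
Proof.
elim: k c => [|k IH] c.
all: split=> //; try by move=> x _; exact: cst_continuous.
move=> i; split=> [x _|]; first exact: derivable_cst.
rewrite (_ : partial i (cst c) = cst 0) ?IH//.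
by apply/funext => x; exact: derive_cst.
Qed.

Lemma is_derive_coord (R : realType) n (x v : 'rV[R]_n) j :
  is_derive x v (fun y : 'rV[R]_n => y ord0 j) (v ord0 j).
Proof.
apply: is_derive_cvg; apply: cvg_near_cst; near=> h.
by rewrite !mxE addrK mulKf//; near: h; exact: nbhs_dnbhs_neq.
Unshelve. all: by end_near. Qed.

Lemma Ck_coord (R : realType) n k (D : set 'rV[R]_n) j :
  Ck k D (fun x => x ord0 j).
Proof.
have cc : forall x, D x -> {for x, continuous (fun x : 'rV[R]_n => x ord0 j)}.
  by move=> x _; exact: coord_continuous.
case: k => [|k]; split=> // i; split=> [x _|].
  by case: (is_derive_coord x (unit_vec i) j).
rewrite (_ : partial i _ = cst ((unit_vec i : 'rV[R]_n) ord0 j)).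
  exact: Ck_cst.
by apply/funext => x; case: (is_derive_coord x (unit_vec i) j).
Qed.

Lemma CkD (R : realType) n k (D : set 'rV[R]_n) f g : open D ->
  Ck k D f -> Ck k D g -> Ck k D (fun x => f x + g x).
Proof.
move=> oD; elim: k f g => [|k IH] f g [fc df] [gc dg].
all: split=> //; try by move=> x Dx; apply: continuousD; [exact: fc|exact: gc].
move=> i; have [dfi cfi] := df i; have [dgi cgi] := dg i; split=> [x Dx|].
  by apply: derivableD; [exact: dfi|exact: dgi].
apply: (eq_Ck oD) (IH _ _ cfi cgi) => x Dx.
by rewrite /partial [RHS]deriveD//; [exact: dfi|exact: dgi].
Qed.

Lemma CkM (R : realType) n k (D : set 'rV[R]_n) f g : open D ->
  Ck k D f -> Ck k D g -> Ck k D (fun x => f x * g x).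
Proof.
move=> oD; elim: k f g => [|k IH] f g fk gk; move: (fk) (gk) => [fc df] [gc dg].
all: split=> //; try by move=> x Dx; apply: continuousM; [exact: fc|exact: gc].
move=> i; have [dfi cfi] := df i; have [dgi cgi] := dg i; split=> [x Dx|].
  by apply: derivableM; [exact: dfi|exact: dgi].
apply: (eq_Ck oD) (CkD oD (IH _ _ (CkW fk) cgi) (IH _ _ (CkW gk) cfi)) => x Dx.
by rewrite /partial [RHS]deriveM//; [exact: dfi|exact: dgi].
Qed.

Lemma CkN (R : realType) n k (D : set 'rV[R]_n) f : open D ->
  Ck k D f -> Ck k D (fun x => - f x).
Proof.
move=> oD fk; apply: (eq_Ck oD) (CkM oD (Ck_cst k D (-1)) fk) => x _.
by rewrite /cst mulN1r.
Qed.

Lemma Ck_sum (R : realType) n m k (D : set 'rV[R]_n) 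
    (f : 'I_m -> _) (P : pred 'I_m) :
  open D -> (forall l, P l -> Ck k D (f l)) ->
  Ck k D (fun x => \sum_(l | P l) f l x).
Proof.
move=> oD fk.
rewrite (_ : (fun x => _) =
  \big[(fun f g x => f x + g x)/cst 0]_(l | P l) f l).
  by elim/big_rec : _ => [|l g Pl gk]; [exact: Ck_cst|exact: CkD (fk _ Pl) gk].
apply/funext => x; elim/big_rec2 : _ => // l g h _.
by move=> ->.
Qed.

Lemma CkV (R : realType) n k (D : set 'rV[R]_n) f : open D ->
  (forall x, D x -> f x != 0) -> Ck k D f -> Ck k D (fun x => (f x)^-1).
Proof.
move=> oD f0; elim: k => [|k IH] fk; move: (fk) => [fc df].
all: split=> //; try by move=> x Dx; apply: continuousV; [exact: f0|exact: fc].
move=> i; have [dfi cfi] := df i; split=> [x Dx|].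
  by apply: derivableV; [exact: f0|exact: dfi].
have fVk := IH (CkW fk).
apply: (eq_Ck oD) (CkM oD (CkM oD (Ck_cst k D (-1)) (CkM oD fVk fVk)) cfi) => x Dx.
rewrite /partial [RHS]deriveV ?f0//; last exact: dfi.
by rewrite /cst mulN1r -invfM -expr2.
Qed.

(** Induction on k: by the chain rule, the partial derivatives of f \o g are sums
    of products of compositions and functions of class C^k. *)
Lemma Ck_comp (R : realType) n m k (U : set 'rV[R]_m) (V : set 'rV[R]_n)
    (f : 'rV[R]_m -> R) (g : 'rV[R]_n -> 'rV[R]_m) :
  open U -> open V -> (forall y, V y -> U (g y)) ->
  Ck k U f -> Ck_map k V g -> Ck k V (f \o g).
Proof.
move=> oU oV VU; elim: k f => [|k IH] f fk gk.
all: have gc y : V y -> {for y, continuous g} by exact: Ck_map_continuous gk.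
all: split=> //; try by move=> y Vy; apply: continuous_comp;
  [exact: gc|exact: Ck_continuous fk (VU _ Vy)].
move=> i.
have dfg y : V y -> is_derive y (unit_vec i) (f \o g)
    (\sum_l partial l f (g y) * partial i (fun y => g y ord0 l) y).
  move=> Vy; apply: is_derive_comp_C1 (VU _ Vy) (gc _ Vy) _ => //.
    exact: Ck_C1 fk.
  by move=> l; have [_ /(_ i)[+ _]] := gk l; exact.
split=> [y /dfg[]//|].
apply: (@eq_Ck _ _ _ _ (fun y => \sum_l
  partial l f (g y) * partial i (fun y => g y ord0 l) y)) => //.
  by move=> y /dfg[].
apply: Ck_sum => // l _; apply: CkM => //.
  apply: (IH (partial l f)) => //; first by have [_ /(_ l)[]] := fk.
  by move=> j; exact: CkW (gk j).
by have [_ /(_ i)[]] := gk l.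
Qed.

(** * Straightening a regular zero set *)

Section straightening.
Context (R : realType) (n k : nat) (w : 'rV[R]_n.+1 -> R) (p : 'rV[R]_n.+1)
  (r : R) (i : 'I_n.+1).
Hypothesis r_gt0 : 0 < r.
Hypothesis w_Ck : Ck k.+1 (ball p r) w.
Hypothesis dw_gt0 : forall x, ball p r x -> 0 < partial i w x.

Let B : set 'rV[R]_n.+1 := ball p r.
Let sw (j : 'I_n.+1) := tperm i ord_max j.

Let oB : open B. Proof. exact: ball_open. Qed.

Let dw x j : B x -> derivable w x (unit_vec j).
Proof. by move=> Bx; have [_ /(_ j)[+ _]] := w_Ck; exact. Qed.

Let sw_i : sw i = ord_max. Proof. exact: tpermL. Qed.
Let sw_max : sw ord_max = i. Proof. exact: tpermR. Qed.
Let swK : involutive sw. Proof. exact: tpermK. Qed.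
Let sw_eqi j : (sw j == i) = (j == ord_max).
Proof. by rewrite -sw_max (inj_eq (inv_inj swK)). Qed.
Let sw_eqmax j : (sw j == ord_max) = (j == i).
Proof. by rewrite -sw_i (inj_eq (inv_inj swK)). Qed.

(** The swap of i and the last index puts the value of w in the coordinate that
    vanishes on the coordinate subspace of codimension one. *)
Definition straighten (x : 'rV[R]_n.+1) : 'rV[R]_n.+1 :=
  \row_j if j == ord_max then w x else x ord0 (sw j).

Let phi := straighten.

Let phi_max x : phi x ord0 ord_max = w x.
Proof. by rewrite mxE eqxx. Qed.

Let phi_sw x j : j != i -> phi x ord0 (sw j) = x ord0 j.
Proof. by move=> ji; rewrite mxE sw_eqmax (negbTE ji) swK. Qed.

Lemma lt_along_coord x h : B x -> B (x + h *: unit_vec i) -> 0 < h ->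
  w x < w (x + h *: unit_vec i).
Proof.
move=> Bx Bxh h0; have h0' := ltW h0.
have Bt (t : R) : Num.min 0 h <= t <= Num.max 0 h -> B (x + t *: unit_vec i).
  rewrite min_l ?max_r// => /andP[t0 th]; apply/rV_ballP => // j.
  have /rV_ballP-/(_ r_gt0 j) := Bx; have /rV_ballP-/(_ r_gt0 j) := Bxh.
  rewrite !mxE eqxx/=; case: (j == i); last by rewrite !mulr0 !addr0.
  by rewrite !mulr1 !ltr_norml => /andP[? ?] /andP[? ?]; apply/andP; split; lra.
have [t th] := @partial_MVT R _ w x i h (fun t ht => @dw _ i (Bt t ht)).
by move=> e; rewrite -subr_gt0 e mulr_gt0// dw_gt0//; exact: Bt.
Qed.

Let phi_inj x y : B x -> B y -> phi x = phi y -> x = y.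
Proof.
move=> Bx By xy.
have xyj j : j != i -> x ord0 j = y ord0 j.
  by move=> ji; rewrite -(phi_sw x ji) xy phi_sw.
have yx : y = x + (y ord0 i - x ord0 i) *: unit_vec i.
  apply/rowP => j; rewrite !mxE eqxx/=; have [->|ji] := eqVneq j i.
    by rewrite mulr1 addrC subrK.
  by rewrite mulr0 addr0 xyj.
have xy' : x = y + (x ord0 i - y ord0 i) *: unit_vec i.
  by rewrite {1}yx -addrA -scalerDl addrA subrK subrr scale0r addr0.
have wxy : w x = w y by rewrite -!phi_max xy.
have [lxy|lyx|e] := ltgtP (x ord0 i) (y ord0 i).
- by have := @lt_along_coord x (y ord0 i - x ord0 i) Bx;
    rewrite -yx subr_gt0 wxy ltxx => /(_ By lxy).
- by have := @lt_along_coord y (x ord0 i - y ord0 i) By;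
    rewrite -xy' subr_gt0 wxy ltxx => /(_ Bx lyx).
- by rewrite yx e subrr scale0r addr0.
Qed.

(** Prescribing the image y fixes all the coordinates of the preimage but the
    i-th.  Since w is increasing in that coordinate, its values at x_i - d/2 and
    x_i + d/2 surround w x, hence still surround the last coordinate of y when
    y is close to the image of x, and the intermediate value theorem provides
    the missing coordinate.  The preimage found is within d of x, so that this
    gives at once that the image of the ball is open and that the inverse is
    continuous. *)
Lemma straighten_open_map x d : B x -> 0 < d -> ball x d `<=` B ->
  \forall y \near phi x, exists2 z, ball x d z & phi z = y.
Proof.
move=> Bx d0 dB.
(* the only candidates for the preimage of y *)
pose base (y : 'rV[R]_n.+1) (t : R) : 'rV[R]_n.+1 :=
  \row_j if j == i then t else y ord0 (sw j).
have base_cont t : continuous (base^~ t).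
  move=> y; apply: (@cvg_rV _ _ _ _ _ _ (nbhs_filter y)) => j; rewrite !mxE.
  under eq_fun do rewrite mxE.
  by case: (j == i); [exact: cvg_cst|exact: coord_continuous].
have d20 : 0 < d / 2 by rewrite divr_gt0.
have base_phi t : base (phi x) (x ord0 i + t) = x + t *: unit_vec i.
  apply/rowP => j; rewrite ![LHS]mxE !mxE eqxx/=.
  have [->|ji] := eqVneq j i; first by rewrite mulr1.
  by rewrite mulr0 addr0 sw_eqmax (negbTE ji) swK.
have Bxt (t : R) : `|t| < d -> ball x d (x + t *: unit_vec i).
  move=> td; apply/rV_ballP => // j; rewrite !mxE eqxx/= opprD addrA subrr sub0r normrN.
  by case: (j == i); rewrite ?mulr1 ?mulr0 ?normr0.
have d2d : `|d / 2| < d by rewrite gtr0_norm//; lra.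
have d2d' : `|- (d / 2)| < d by rewrite normrN.
have w_base_cont t : `|t| < d ->
    {for phi x, continuous (fun y => w (base y (x ord0 i + t)))}.
  move=> td; apply: (@continuous_comp _ _ _ (base^~ (x ord0 i + t)) w).
    exact: base_cont.
  by apply: (Ck_continuous w_Ck); rewrite base_phi; exact/dB/Bxt.
have lo : w (base (phi x) (x ord0 i + - (d / 2))) < phi x ord0 ord_max.
  rewrite base_phi phi_max.
  have := @lt_along_coord (x + (- (d / 2)) *: unit_vec i) (d / 2).
  rewrite -addrA -scalerDl addNr scale0r addr0; apply => //.
  exact/dB/Bxt.
have hi : phi x ord0 ord_max < w (base (phi x) (x ord0 i + d / 2)).
  by rewrite base_phi phi_max; apply: lt_along_coord => //; exact/dB/Bxt.
have cmax : {for phi x, continuous (fun y : 'rV[R]_n.+1 => y ord0 ord_max)}.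
  exact: coord_continuous.
near=> y.
have xy : ball (phi x) d y by near: y; exact: nbhsx_ballx.
have lo_y : w (base y (x ord0 i + - (d / 2))) < y ord0 ord_max.
  near: y; rewrite near_simpl; rewrite -subr_gt0 in lo.
  have /cvgr_gt/(_ _ lo) := continuousB cmax (w_base_cont _ d2d').
  by apply: filterS => y; rewrite subr_gt0.
have hi_y : y ord0 ord_max < w (base y (x ord0 i + d / 2)).
  near: y; rewrite near_simpl; rewrite -subr_gt0 in hi.
  have /cvgr_gt/(_ _ hi) := continuousB (w_base_cont _ d2d) cmax.
  by apply: filterS => y; rewrite subr_gt0.
have ball_base t : x ord0 i - d / 2 <= t <= x ord0 i + d / 2 -> ball x d (base y t).
  move=> td; apply/rV_ballP => // j; rewrite mxE; case: eqP => [->|/eqP ji].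
    by rewrite ltr_norml; apply/andP; split; lra.
  by have /rV_ballP-/(_ d0 (sw j)) := xy; rewrite phi_sw.
have le_d : x ord0 i - d / 2 <= x ord0 i + d / 2 by lra.
have [||t] := @IVT R (fun t => w (base y t)) _ _ (y ord0 ord_max) le_d.
- apply: continuous_subspace_itv => t; rewrite in_itv/= => td.
  apply: (@continuous_comp _ _ _ (base y) w); last first.
    exact: Ck_continuous w_Ck (dB _ (ball_base _ td)).
  apply: cvg_rV => j; rewrite !mxE; under eq_fun do rewrite mxE.
  by case: (j == i); [exact: cvg_id|exact: cvg_cst].
- rewrite min_l ?max_r ?(ltW lo_y) ?(ltW hi_y)//; exact: ltW (lt_trans lo_y hi_y).
rewrite in_itv/= => td wt; exists (base y t); first exact: ball_base.
apply/rowP => j; rewrite mxE; case: eqP => [->//|/eqP jm].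
by rewrite mxE sw_eqi (negbTE jm) swK.
Unshelve. all: by end_near. Qed.

Let V : set 'rV[R]_n.+1 := phi @` B.

Let ball_in (x : 'rV[R]_n.+1) (e : R) : B x -> 0 < e ->
  exists d, [/\ 0 < d, ball x d `<=` B & ball x d `<=` ball x e].
Proof.
move=> Bx e0.
have /nbhs_ballP[d /= d0 dB] : nbhs x B by exact: open_nbhs_nbhs.
exists (Num.min d e); rewrite lt_min d0 e0; split=> // y /= xy.
  by apply/dB/(le_ball _ xy); rewrite ge_min lexx.
by apply: (le_ball _ xy); rewrite ge_min lexx orbT.
Qed.

Let oV : open V.
Proof.
rewrite openE => _ [x Bx <-].
have [d [d0 dB _]] := ball_in Bx ltr01.
apply: filterS (straighten_open_map Bx d0 dB) => y [z xz <-].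
by exists z => //; exact: dB.
Qed.

Definition unstraighten (y : 'rV[R]_n.+1) : 'rV[R]_n.+1 :=
  xget p [set x | B x /\ phi x = y].

Let psi := unstraighten.

Let psiP y : V y -> B (psi y) /\ phi (psi y) = y.
Proof.
by move=> [x Bx xy]; apply: (@xgetPex _ p [set x | B x /\ phi x = y]); exists x.
Qed.

Let phiK x : B x -> psi (phi x) = x.
Proof.
move=> Bx; have [Bpsi e] := psiP (imageP phi Bx).
exact: phi_inj e.
Qed.

Let psi_cont y : V y -> {for y, continuous psi}.
Proof.
move=> [x Bx <-] A /nbhs_ballP[e /= e0]; rewrite phiK// => eA.
have [d [d0 dB de]] := ball_in Bx e0.
apply: (filterS _ (straighten_open_map Bx d0 dB)) => _ [z xz <-].
by apply: eA; rewrite phiK; [exact: de|exact: dB].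
Qed.

Let psi_coord_cont j y : V y -> {for y, continuous (fun y => psi y ord0 j)}.
Proof.
move=> Vy; apply: (@continuous_comp _ _ _ psi (fun x : 'rV[R]_n.+1 => x ord0 j)).
  exact: psi_cont.
exact: coord_continuous.
Qed.

Let w_psi y : V y -> w (psi y) = y ord0 ord_max.
Proof. by move=> /psiP[_ {2}<-]; rewrite phi_max. Qed.

Let psi_sw y j : V y -> j != i -> psi y ord0 j = y ord0 (sw j).
Proof. by move=> /psiP[_ {2}<-] ji; rewrite phi_sw. Qed.

(** The implicit differentiation formula for the coordinate i of the inverse:
    differentiate w (psi y) = y_max, where the coordinate j <> i of psi y is
    y_(sw j). *)
Let dpsi (l : 'I_n.+1) (y : 'rV[R]_n.+1) : R :=
  ((ord_max == l)%:R - \sum_(j | j != i) partial j w (psi y) * (sw j == l)%:R)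
  * (partial i w (psi y))^-1.

Let near_line (y v : 'rV[R]_n.+1) (A : set 'rV[R]_n.+1) : nbhs y A ->
  \forall h \near (0:R)^', A (h *: v + y).
Proof. by move=> yA; exact: (@cvg_along R _ _ id y v (fun=> id)). Qed.

(** The expansion of w at psi y, evaluated along y + h e_l, is a linear equation
    for the increment of the coordinate i of psi; solving it and dividing by h
    gives a difference quotient that visibly converges. *)
Lemma is_derive_unstraighten y l : V y ->
  is_derive y (unit_vec l) (fun y => psi y ord0 i) (dpsi l y).
Proof.
move=> Vy; have [Bx phix] := psiP Vy.
have [a [ac aE]] := caratheodory_C1 oB Bx (Ck_C1 w_Ck).
have ac' j : a j (psi (h *: unit_vec l + y)) @[h --> (0:R)^'] --> partial j w (psi y).
  exact: (@cvg_comp _ _ _ (fun h : R => psi (h *: unit_vec l + y)) (a j) _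
    (nbhs (psi y)) _ (cvg_along (unit_vec l) (psi_cont Vy)) (ac j)).
have di0 : partial i w (psi y) != 0 by rewrite gt_eqF// dw_gt0.
apply: is_derive_cvg.
pose q h := ((ord_max == l)%:R - \sum_(j | j != i)
    a j (psi (h *: unit_vec l + y)) * (sw j == l)%:R)
  * (a i (psi (h *: unit_vec l + y)))^-1.
have : q h @[h --> (0:R)^'] --> dpsi l y.
  apply: cvgM; last exact: cvgV.
  apply: cvgB; first exact: cvg_cst.
  apply: cvg_big => [|j _]; first exact: add_continuous.
  by apply: cvgM; [exact: ac'|exact: cvg_cst].
apply: cvg_trans; apply: near_eq_cvg; near=> h.
have h0 : h != 0 by near: h; exact: nbhs_dnbhs_neq.
have Vh : V (h *: unit_vec l + y).
  by near: h; apply: near_line; exact: open_nbhs_nbhs.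
have ai0 : a i (psi (h *: unit_vec l + y)) != 0.
  near: h; have /cvgr_neq0 := ac' i; exact.
rewrite /q; set z := h *: _ + y in Vh ai0 *.
have zj j : z ord0 j - y ord0 j = h * (j == l)%:R.
  by rewrite !mxE addrK eqxx.
have := aE (psi z); rewrite !w_psi// zj (bigD1 i)//= => hE.
have {}hE : h * (ord_max == l)%:R = a i (psi z) * (psi z ord0 i - psi y ord0 i) +
    h * \sum_(j | j != i) a j (psi z) * (sw j == l)%:R.
  rewrite hE mulr_sumr; congr (_ + _); apply: eq_bigr => j ji.
  by rewrite !psi_sw// zj mulrCA.
apply: (mulfI h0); rewrite mulrA mulrBr hE addrK mulrC mulKf//.
by rewrite mulrA mulfV// mul1r.
Unshelve. all: by end_near. Qed.

(** Bootstrapping: the derivatives of psi are expressed by the derivatives of w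
    composed with psi, so each degree of smoothness of psi gives the next one,
    as long as w has it. *)
Lemma Ck_unstraighten : Ck_map k.+1 V psi.
Proof.
have psi_j m j : j != i -> Ck m V (fun y => psi y ord0 j).
  move=> ji; apply: (eq_Ck oV) (Ck_coord m V (sw j)) => y Vy.
  by rewrite psi_sw.
have step m : (forall j, Ck m B (partial j w)) -> Ck_map m V psi -> Ck_map m.+1 V psi.
  move=> wm pm j; have [->|ji] := eqVneq j i; last exact: psi_j.
  split=> [y Vy|l].
    exact: psi_coord_cont.
  split=> [y Vy|]; first by case: (is_derive_unstraighten l Vy).
  have wpm j' : Ck m V (partial j' w \o psi).
    by apply: (Ck_comp oB oV) => // y /psiP[].
  apply: (@eq_Ck _ _ _ _ (dpsi l)) => //.
    by move=> y Vy; case: (is_derive_unstraighten l Vy).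
  apply: CkM => //; last first.
    by apply: (CkV oV _ (wpm i)) => y Vy; rewrite /=  gt_eqF// dw_gt0//; case: (psiP Vy).
  apply: (CkD oV (Ck_cst m V _)).
  apply: CkN => //; apply: Ck_sum => // j' _.
  by apply: (CkM oV (wpm j')); exact: Ck_cst.
have : forall j, Ck k B (partial j w) by move=> j; have [_ /(_ j)[]] := w_Ck.
elim: (k) => [|m IH] wm; apply: step => //.
  by move=> j; split=> // y Vy; exact: psi_coord_cont.
by apply: IH => j; exact: CkW.
Qed.

Lemma straighten_diffeo : open V /\ Ck_diffeo k.+1 B V phi.
Proof.
split=> //; exists psi; split.
- move=> j; have [->|jm] := eqVneq j ord_max.
    by apply: (eq_Ck oB) w_Ck => x _; rewrite phi_max.
  apply: (eq_Ck oB) (Ck_coord k.+1 B (sw j)) => x _.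
  by rewrite mxE (negbTE jm).
- exact: Ck_unstraighten.
- by move=> x Bx; split; [exact: imageP|exact: phiK].
- by move=> y /psiP.
Qed.

Lemma straighten_slice (S : set 'rV[R]_n.+1) :
  (forall x, B x -> S x <-> w x = 0) ->
  phi @` (B `&` S) = V `&` coord_subspace R n.+1 n.
Proof.
move=> SE; apply/seteqP; split=> [_ [x [Bx Sx] <-]|_ [[x Bx <-] x0]].
  split=> [|j nj]; first exact: imageP.
  rewrite (_ : j = ord_max) ?phi_max; first exact/(SE _ Bx).
  by apply/val_inj/eqP; rewrite eqn_leq nj -ltnS ltn_ord.
by exists x => //; split=> //; apply/(SE _ Bx); rewrite -phi_max x0.
Qed.

End straightening.

(** Multiplying w by s = partial_i w p makes the i-th partial derivative positive
    at p, its value being s^2, without changing the zeros of w. *)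
Lemma increasing_multiple (R : realType) n k (W : set 'rV[R]_n.+1)
    (w : 'rV[R]_n.+1 -> R) (p : 'rV[R]_n.+1) :
  open W -> Ck k.+1 W w -> W p -> grad w p != 0 ->
  exists (s r : R) (i : 'I_n.+1),
    [/\ s != 0, 0 < r, ball p r `<=` W,
        Ck k.+1 (ball p r) (fun x => s * w x) &
        forall x, ball p r x -> 0 < partial i (fun x => s * w x) x].
Proof.
move=> oW wk Wp dw.
have [i di0] := (grad_neq0P w p).1 dw.
pose s := partial i w p; pose sw x := s * w x.
have swk : Ck k.+1 W sw by apply: CkM => //; exact: Ck_cst.
have dsw x : W x -> partial i sw x = s * partial i w x.
  move=> Wx; rewrite /partial /sw.
  have [_ /(_ i)[/(_ _ Wx) dwx _]] := wk.
  exact: (@deriveMl R _ w s x).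
have : \forall x \near p, W x /\ 0 < partial i sw x.
  have p0 : 0 < partial i sw p by rewrite dsw// -expr2 exprn_even_gt0.
  have cp : {for p, continuous (partial i sw)}.
    by have [_ /(_ i)[_ di]] := swk; exact: Ck_continuous di Wp.
  near=> x; split; near: x; first exact: open_nbhs_nbhs.
  by have /cvgr_gt := cp; exact.
move=> /nbhs_ballP[r /= r0 rW]; exists s, r, i; split=> //.
- by move=> x /rW[].
- by apply: Ck_subset swk => x /rW[].
- by move=> x /rW[].
Unshelve. all: by end_near. Qed.

Lemma regular_zero_set_submanifold (R : realType) n k (W : set 'rV[R]_n.+1)
    (w : 'rV[R]_n.+1 -> R) (S : set 'rV[R]_n.+1) :
  open W -> Ck k.+1 W w -> S `<=` W ->
  (forall x, W x -> S x <-> w x = 0) ->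
  (forall x, S x -> grad w x != 0) ->
  embedded_submanifold n k.+1 S.
Proof.
move=> oW wk SW SE dw p Sp.
have [s [r [i [s0 r0 rW swk dsw0]]]] :=
  increasing_multiple oW wk (SW _ Sp) (dw _ Sp).
have [oV diffeo] := straighten_diffeo r0 swk dsw0.
set sw := fun x => s * w x in swk dsw0 oV diffeo.
exists (ball p r), (straighten sw i @` ball p r), (straighten sw i); split=> //.
- exact: ball_open.
- exact: ballxx.
- apply: straighten_slice => x /rW Wx.
  rewrite (SE _ Wx) /sw; split=> [->|/eqP]; first by rewrite mulr0.
  by rewrite mulf_eq0 (negbTE s0) => /eqP.
Qed.

(** * Stability of the zeros under small perturbations *)

Lemma near_perturbation_neq0 (R : realType) (T : topologicalType) (f g : T -> R) x :
  {for x, continuous f} -> {for x, continuous g} -> f x != 0 ->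
  \forall x' \near x & e \near (0 : R), f x' + e * g x' != 0.
Proof.
move=> fc gc fx0.
have : f z.1 + z.2 * g z.1 @[z --> filter_prod (nbhs x) (nbhs (0 : R))] -->
    f x + 0 * g x.
  apply: cvgD; last apply: cvgM.
  - exact: (@cvg_comp _ _ _ fst f _ _ _ (@cvg_fst _ _ (nbhs x) (nbhs (0:R)) _) fc).
  - exact: cvg_snd.
  - exact: (@cvg_comp _ _ _ fst g _ _ _ (@cvg_fst _ _ (nbhs x) (nbhs (0:R)) _) gc).
by rewrite mul0r addr0 => /cvgr_neq0/(_ fx0).
Qed.

(** The family indexed by I serves both for the gradient, where some partial
    derivative is nonzero, and for a single function. *)
Lemma compact_near_perturbation_neq0 (R : realType) (T : topologicalType)
    (I : finType) (K : set T) (f g : I -> T -> R) : compact K ->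
  (forall i x, K x -> {for x, continuous (f i)}) ->
  (forall i x, K x -> {for x, continuous (g i)}) ->
  (forall x, K x -> exists i, f i x != 0) ->
  \forall e \near (0 : R), forall x, K x -> exists i, f i x + e * g i x != 0.
Proof.
move=> /compact_near_coveringP cK fc gc f0.
apply: (cK R (nbhs (0:R)) (fun e x => exists i, f i x + e * g i x != 0)) => x Kx.
have [i fi] := f0 _ Kx.
have := near_perturbation_neq0 (fc i x Kx) (gc i x Kx) fi.
by apply: filterS => -[x' e] /=; exists i.
Qed.

Lemma compact_in_open_ball (R : realType) (V : normedModType R) (K G : set V) :
  compact K -> open G -> K `<=` G ->
  exists2 r : R, 0 < r & forall x, K x -> ball x r `<=` G.
Proof.
move=> /compact_near_coveringP cK oG KG.
have : \forall r \near (0:R)^'+, K `<=` [set x | ball x r `<=` G].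
  apply: (cK R (0:R)^'+ (fun r x => ball x r `<=` G)) => x Kx.
  have /nbhs_ballP[d /= d0 dG] : nbhs x G by apply: open_nbhs_nbhs; split => //; exact: KG.
  have d20 : 0 < d / 2 by rewrite divr_gt0.
  exists (ball x (d / 2), [set r | r <= d / 2]).
    by split=> /=; [exact: nbhsx_ballx|exact: nbhs_right_le].
  move=> [x' r] /= [xx' rd] y x'y; apply: dG; rewrite [d]splitr.
  exact: ball_triangle xx' (le_ball rd x'y).
move=> H.
near (0:R)^'+ => r; exists r; first by near: r; exact: nbhs_right_gt.
by near: r.
Unshelve. all: by end_near. Qed.

Section perturbation.
Context (R : realType) (n k : nat) (D : set 'rV[R]_n.+1) (u v : 'rV[R]_n.+1 -> R).
Hypotheses (oD : open D) (u_Ck : Ck k.+1 D u) (v_Ck : Ck k.+1 D v).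

Let ue (e : R) x := u x + e * v x.

Let ue_Ck e : Ck k.+1 D (ue e).
Proof. by apply: CkD => //; apply: CkM => //; exact: Ck_cst. Qed.

Let partial_ue e i x : D x -> partial i (ue e) x = partial i u x + e * partial i v x.
Proof.
move=> Dx; have [_ /(_ i)[/(_ _ Dx) du _]] := u_Ck.
have [_ /(_ i)[/(_ _ Dx) dv _]] := v_Ck.
rewrite /partial /ue -(deriveMl e dv); apply: (deriveD du).
exact: (derivableM (derivable_cst e x _) dv).
Qed.

Let cpartial (f : 'rV[R]_n.+1 -> R) i x : Ck k.+1 D f -> D x ->
  {for x, continuous (partial i f)}.
Proof. by move=> [_ /(_ i)[_ di]] Dx; exact: Ck_continuous di Dx. Qed.

(** A zero where the gradient does not vanish is crossed with a change of sign
    along some coordinate axis, and a change of sign between two fixed points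
    survives a small perturbation. *)
Lemma near_zero_of_perturbation (W : set 'rV[R]_n.+1) (p : 'rV[R]_n.+1) :
  open W -> W `<=` D -> W p -> u p = 0 -> grad u p != 0 ->
  \forall e \near (0 : R), exists2 x, W x & ue e x = 0.
Proof.
move=> oW WD Wp up dup.
have [s [r [i [s0 r0 rW swk dsw0]]]] :=
  increasing_multiple oW (Ck_subset WD u_Ck) Wp dup.
pose h := r / 2.
have h0 : 0 < h by rewrite divr_gt0.
have hr : h < r by rewrite /h; lra.
have inW (t : R) : `|t| < r -> ball p r (p + t *: unit_vec i).
  move=> tr; apply/rV_ballP => // j; rewrite !mxE eqxx/= opprD addrA subrr sub0r normrN.
  by case: (j == i); rewrite ?mulr1 ?mulr0 ?normr0.
have inWh : ball p r (p + h *: unit_vec i) by apply: inW; rewrite gtr0_norm.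
have inWNh : ball p r (p + (- h) *: unit_vec i).
  by apply: inW; rewrite normrN gtr0_norm.
have hi : 0 < s * u (p + h *: unit_vec i).
  have := lt_along_coord r0 swk dsw0 (ballxx p r0) inWh h0.
  by rewrite up mulr0.
have lo : s * u (p + (- h) *: unit_vec i) < 0.
  have := @lt_along_coord _ _ _ _ _ _ _ r0 swk dsw0 (p + (- h) *: unit_vec i) h inWNh.
  rewrite -addrA -scalerDl addNr scale0r addr0 up mulr0; apply => //.
  exact: ballxx.
have ce x : s * ue e x @[e --> (0:R)] --> s * u x.
  rewrite (_ : u x = u x + 0 * v x); last by rewrite mul0r addr0.
  apply: cvgM; first exact: cvg_cst.
  apply: cvgD; first exact: cvg_cst.
  by apply: cvgM; [exact: cvg_id|exact: cvg_cst].
near=> e.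
have hi_e : 0 < s * ue e (p + h *: unit_vec i).
  by near: e; have /cvgr_gt := ce (p + h *: unit_vec i); exact.
have lo_e : s * ue e (p + (- h) *: unit_vec i) < 0.
  by near: e; have /cvgr_lt := ce (p + (- h) *: unit_vec i); exact.
have le_h : - h <= h by lra.
have [||t] := @IVT R (fun t => s * ue e (p + t *: unit_vec i)) _ _ 0 le_h.
- apply: continuous_subspace_itv => t; rewrite in_itv/= => /andP[t1 t2].
  apply: cvgM; first exact: cvg_cst.
  apply: (@continuous_comp _ _ _ (fun t : R => p + t *: unit_vec i) (ue e)).
    apply: cvgD; first exact: cvg_cst.
    by apply: cvgZr_tmp; exact: cvg_id.
  apply: Ck_continuous (ue_Ck e) _; apply/WD/rW/inW.
  by rewrite ltr_norml; apply/andP; split; lra.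
- by rewrite min_l ?max_r ?(ltW lo_e) ?(ltW hi_e)//; exact: ltW (lt_trans lo_e hi_e).
rewrite in_itv/= => /andP[t1 t2] /eqP; rewrite mulf_eq0 (negbTE s0)/= => /eqP uet.
exists (p + t *: unit_vec i) => //; apply/rW/inW.
by rewrite ltr_norml; apply/andP; split; lra.
Unshelve. all: by end_near. Qed.

(** The zeros are sought in the closure N of the r/2-neighbourhood W of S, with r
    so small that the r-balls centred on S avoid the critical points of u and the
    complement of D.  Compactness of N \ W keeps the zeros inside W, where they
    form a regular zero set. *)
Lemma regular_zero_set_persists (S : set 'rV[R]_n.+1) : bounded_set D ->
  S !=set0 -> compact S -> S = [set x | D x /\ u x = 0] ->
  (forall x, S x -> grad u x != 0) ->
  exists eps0 : R, 0 < eps0 /\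
    forall eps : R, 0 < eps -> eps < eps0 ->
      exists S_eps : set 'rV[R]_n.+1,
        [/\ [/\ S_eps !=set0, compact S_eps & embedded_submanifold n k.+1 S_eps],
            S_eps `<=` D & forall x, S_eps x -> u x + eps * v x = 0].
Proof.
move=> bD [p Sp] cS SE dS.
have SD : S `<=` D by move=> x; rewrite SE => -[].
pose G := [set x | D x /\ exists i, partial i u x != 0].
have oG : open G.
  rewrite openE => x [Dx [i di]].
  have xD : nbhs x D by exact: open_nbhs_nbhs.
  have /cvgr_neq0/(_ di) := @cpartial u i x u_Ck Dx.
  by apply: filterS2 xD => y Dy diy; split=> //; exists i.
have SG : S `<=` G by move=> x Sx; split; [exact: SD|exact/grad_neq0P/dS].
have [r r0 rG] := compact_in_open_ball cS oG SG.
pose W := \bigcup_(s in S) ball s (r / 2).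
have r20 : 0 < r / 2 by rewrite divr_gt0.
have oW : open W by apply: bigcup_open => s _; exact: ball_open.
have SW : S `<=` W by move=> s Ss; exists s => //; exact: ballxx.
pose N := closure W.
have WN : W `<=` N by exact: subset_closure.
have NG : N `<=` G.
  move=> y Ny; have [z [[s Ss sz] yz]] := Ny _ (nbhsx_ballx y _ r20).
  apply: (rG _ Ss); rewrite [r]splitr; apply: (ball_triangle sz).
  exact: ball_sym.
have ND : N `<=` D by move=> x /NG[].
have cN : compact N.
  apply: bounded_closed_compact; last exact: closed_closure.
  have [M [Mr DM]] := bD; exists M; split=> // M' MM x /ND; exact: DM.
have cNW : compact (N `\` W).
  rewrite setDE; apply: compact_closedI => //; exact: open_closedC.
have E1 : \forall e \near (0 : R), forall x, N x ->
    exists i, partial i u x + e * partial i v x != 0.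
  apply: compact_near_perturbation_neq0 => // [i x /ND Dx|i x /ND Dx|x /NG[]//].
  - exact: cpartial.
  - exact: cpartial.
have E2 : \forall e \near (0 : R), forall x, (N `\` W) x ->
    exists i : unit, ue e x != 0.
  apply: (@compact_near_perturbation_neq0 _ _ unit _ (fun=> u) (fun=> v) cNW)
      => [_ x [/ND Dx _]|_ x [/ND Dx _]|x [/ND Dx nWx]].
  - exact: Ck_continuous u_Ck Dx.
  - exact: Ck_continuous v_Ck Dx.
  - by exists tt; apply/eqP => ux0; apply/nWx/SW; rewrite SE.
have WD : W `<=` D by move=> x /WN/ND.
have up0 : u p = 0 by move: Sp; rewrite SE => -[].
have E3 := near_zero_of_perturbation oW WD (SW _ Sp) up0 (dS _ Sp).
have [d /= d0 dE] := (nbhs_ballP _ _).1 (filterI E1 (filterI E2 E3)).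
exists d; split=> // e e0 ed.
have [|E1e [E2e [x0 Wx0 uex0]]] := dE e.
  by rewrite /ball/= sub0r normrN gtr0_norm.
pose Se := [set x | N x /\ ue e x = 0].
have SeW : Se `<=` W.
  move=> x [Nx ux]; apply: contrapT => nWx.
  by have [_] := E2e x (conj Nx nWx); rewrite ux eqxx.
exists Se; split; last 2 first.
- by move=> x [/ND].
- by move=> x [].
split.
- by exists x0; split=> //; exact: WN.
- apply: (subclosed_compact _ cN); last by move=> x [].
  move=> x xSe; have Nx : N x.
    by apply: (closed_closure (A := W)); apply: closure_subset xSe => y [].
  split=> //; apply: contrapT => /eqP ux.
  have /cvgr_neq0/(_ ux) := Ck_continuous (ue_Ck e) (ND _ Nx).
  by move=> /xSe[y [[_ uy]]] /=; rewrite uy eqxx.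
- apply: (regular_zero_set_submanifold oW (Ck_subset WD (ue_Ck e)) SeW).
    by move=> x Wx; split=> [[]//|ux]; split=> //; exact: WN.
  move=> x [Nx _]; apply/grad_neq0P; have [i di] := E1e _ Nx.
  by exists i; rewrite partial_ue//; exact: ND.
Qed.

End perturbation.

Theorem theorem1 (R : realType) (D : set 'rV[R]_3) (u v : 'rV[R]_3 -> R)
    (S : set 'rV[R]_3) (c1 : R)
    (D_domain : domain D) (D_bounded : bounded_set D)
    (u_C3 : Ck 3 D u)
    (S_surface : closed_surface 3 S) (S_connected : connected S)
    (S_sub : S `<=` D) (S_zeros : S = [set x | D x /\ u x = 0])
    (c1_gt0 : 0 < c1)
    (grad_lb : 2 * c1 <= inf [set enorm (grad u s) | s in S])
    (v_C3 : Ck 3 D v) :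
  exists eps0 : R, 0 < eps0 /\
    forall eps : R, 0 < eps -> eps < eps0 ->
      exists S_eps : set 'rV[R]_3,
        [/\ closed_surface 3 S_eps, S_eps `<=` D &
            forall x, S_eps x -> u x + eps * v x = 0].
Proof.
have [_ oD _] := D_domain; have [S0 cS _] := S_surface.
apply: (regular_zero_set_persists oD u_C3 v_C3 D_bounded S0 cS S_zeros) => x Sx.
have : enorm (grad u x) != 0.
  rewrite gt_eqF//; apply: (@lt_le_trans _ _ (2 * c1)); first by rewrite mulr_gt0.
  apply: (le_trans grad_lb); apply: ge_inf; last by exists x.
  by exists 0 => _ [y _ <-]; exact: sqrtr_ge0.
apply: contra_neq => ->; rewrite /enorm big1 ?sqrtr0// => i _.
by rewrite mxE expr0n.
Qed.
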